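(* Let $p$ be a prime and $\lambda$ a regular cardinal such that for some cardinal $\mu$, $\mu^+<\lambda<\mu^{\aleph_0}$. Then there is no separable $p$-group $G$ of cardinality $\lambda$ such that every separable $p$-group of cardinality at most $\lambda$ is isomorphic to a pure subgroup of $G$.
   Context: Groups are abelian. A separable $p$-group is an abelian $p$-group with no nonzero elements of infinite height. A subgroup $H\subseteq G$ is pure if $mH=mG\cap H$ for all natural $m$, where $mG=\{mg:g\in G\}$.
   Formalization: The cardinal μ is taken to be infinite; for finite μ the claim fails (μ = 2, λ = ℵ₀: the direct sum over n ≥ 1 of ℵ₀ copies of Z(p^n) is universal). *)

(* Defs.v *)
From HB Require Import structures.
From mathcomp Require Import all_boot all_order all_algebra.
From mathcomp Require Import wochoice all_classical.

Set Implicit Arguments.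
Unset Strict Implicit.
Unset Printing Implicit Defensive.

Import GRing.Theory.

Local Open Scope classical_set_scope.
Local Open Scope card_scope.
Local Open Scope ring_scope.

(** A cardinal is represented by an arbitrary type having that cardinality, and
    compared with others through [#<=] and [#=].  In particular the cardinal
    power [M ^ aleph_0] is represented by the type [nat -> M]. *)

Definition card_lt T U (A : set T) (B : set U) : Prop :=
  A #<= B /\ ~ (B #<= A).
Notation "A '#<' B" := (card_lt A B) (at level 79) : card_scope.

Definition is_card_succ (M S : Type) : Prop :=
  [set: M] #< [set: S] /\
  forall K : Type, [set: M] #< [set: K] -> [set: S] #<= [set: K].

(** [R] is a reflexive well-order on [T] whose order type is an initial ordinal,
    i.e. the cardinal of [T] in the von Neumann sense.  ([well_order] forces [R]
    to be a total order: apply it to subsets of at most three elements.) *)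
Definition initial_well_order T (R : rel T) : Prop :=
  well_order R /\ forall x, [set y | R y x /\ y <> x] #< [set: T].

Definition cofinal T (R : rel T) (A : set T) : Prop :=
  forall x, exists2 y, A y & R x y.

(** An infinite cardinal equal to its own cofinality.  A well-order as below
    exists on every type and is unique up to isomorphism. *)
Definition regular_cardinal (L : Type) : Prop :=
  infinite_set [set: L] /\
  exists R : rel L, initial_well_order R /\
    forall A : set L, cofinal R A -> A #= [set: L].

Definition p_group (p : nat) (G : zmodType) : Prop :=
  forall x : G, exists n : nat, x *+ (p ^ n)%N = 0.

Definition infinite_height (p : nat) (G : zmodType) (x : G) : Prop :=
  forall n : nat, exists y : G, x = y *+ (p ^ n)%N.

Definition separable_p_group (p : nat) (G : zmodType) : Prop :=
  p_group p G /\ ~ exists x : G, x != 0 /\ infinite_height p x.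

Definition multiples (G : zmodType) (m : nat) (A : set G) : set G :=
  [set x *+ m | x in A].

Definition subgroup (G : zmodType) (H : set G) : Prop := zmod_closed (mem H).

Definition pure_subgroup (G : zmodType) (H : set G) : Prop :=
  subgroup H /\ forall m : nat, multiples m H = multiples m [set: G] `&` H.

Definition isomorphic_to_subset (A G : zmodType) (H : set G) : Prop :=
  exists f : {additive A -> G}, injective f /\ range f = H.

Definition purely_embeddable (A G : zmodType) : Prop :=
  exists H : set G, pure_subgroup H /\ isomorphic_to_subset A H.

(* Main.v *)
(** Shelah's invariants.  Enumerate a group [G] of size [L] and filter it by initial
    segments of [L].  Given a set [C] of points of [L], the trace of [g : G] records
    for which [a] in [C] and which [n] the element [g] lies in [G_a + p^(n+1) G].
    Club guessing (available since [M^+ < L]) gives [L] many sets [C], of order type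
    that of [nat * M], one of which is inside any prescribed club of [L]; so [G]
    has at most [L] traces.  Any [F : nat -> M] yields the increasing sequence
    [n |-> (n, F n)], and there is a separable p-group of size at most [L]
    with, for every [C], an element whose trace codes that sequence.  A pure embedding
    into [G] preserves traces along a club, hence along some guessed [C], so [G]
    would have at least [M ^ aleph_0 > L] traces. *)

Require Import Defs.
From HB Require Import structures.
From mathcomp Require Import all_boot all_order all_algebra.
From mathcomp Require Import wochoice all_classical.

Set Implicit Arguments.
Unset Strict Implicit.
Unset Printing Implicit Defensive.

Local Open Scope classical_set_scope.
Local Open Scope card_scope.

(** * Comparing cardinals by injections and surjections *)

Lemma card_leI T U (A : set T) (B : set U) (f : T -> U) :
  (forall x, A x -> B (f x)) ->
  (forall x y, A x -> A y -> f x = f y -> x = y) -> A #<= B.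
Proof.
move=> fAB finj; have : $|{injfun A >-> B}|.
  by apply/injfunPex; exists f => // x y /set_mem Ax /set_mem Ay; exact: finj.
by case=> g; exact: inj_card_le g.
Qed.

Lemma card_leE T U (A : set T) (B : set U) (b : U) : A #<= B ->
  exists f : T -> U, (forall x, A x -> B (f x)) /\
    (forall x y, A x -> A y -> f x = f y -> x = y).
Proof.
move=> /card_leP[f].
exists (fun x => if pselect (A x) is left Ax then set_val (f (SigSub (mem_set Ax))) else b).
split=> [x Ax|x y Ax Ay].
  by case: pselect => // Ax'; exact: set_valP.
case: pselect => // Ax'; case: pselect => // Ay' /val_inj.
have finj : injective f by move=> u v; apply: inj; rewrite in_setT.
by move=> /finj /(congr1 val).
Qed.

Lemma card_le_surj T U (A : set T) (B : set U) (f : T -> U) :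
  (forall y, B y -> exists2 x, A x & f x = y) -> B #<= A.
Proof.
move=> surjf; have [->|/set0P[y0 By0]] := eqVneq B set0; first exact: card_ge0.
have [x0 _ _] := surjf y0 By0.
have /choice[g gP] : forall y, exists x, B y -> A x /\ f x = y.
  move=> y; have [By|nBy] := pselect (B y); last by exists x0.
  by have [x Ax fx] := surjf y By; exists x.
apply: (@card_leI _ _ _ _ g) => [y /gP[]//|x y /gP[_ {2}<-] /gP[_ {2}<-] ->//].
Qed.

Lemma card_le_setX T T' U U' (A : set T) (A' : set T') (B : set U) (B' : set U') :
  A #<= B -> A' #<= B' -> A `*` A' #<= B `*` B'.
Proof.
move=> AB AB'.
have [->|/set0P[[a a'] [/= Aa Aa']]] := eqVneq (A `*` A') set0; first exact: card_ge0.
have ex V W (C : set V) (D : set W) (x : V) : C x -> C #<= D -> exists y : W, True.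
  move=> Cx CD; have [D0|/set0P[y _]] := eqVneq D set0; last by exists y.
  by move: CD; rewrite D0 => /card_le0P C0; rewrite C0 in Cx.
have [b _] := ex _ _ _ _ _ Aa AB; have [b' _] := ex _ _ _ _ _ Aa' AB'.
have [f [fB finj]] := card_leE b AB; have [f' [fB' finj']] := card_leE b' AB'.
apply: (@card_leI _ _ _ _ (fun z => (f z.1, f' z.2))) => [[x y]|[x y] [z t]] /=.
  by move=> [/= ? ?]; split; [exact: fB|exact: fB'].
by move=> [/= ? ?] [/= ? ?] [/finj-> // /finj'->].
Qed.

(** Hilbert's hotel: [x] moves to [f 0], each [f n] moves to [f n.+1], and all other points stay. *)
Lemma infinite_add1 T (A : set T) (x : T) : infinite_set A -> A `|` [set x] #<= A.
Proof.
move=> /infiniteP NA; have [f [fA finj]] := card_leE x NA.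
have [Ax|nAx] := pselect (A x).
  by rewrite (_ : _ `|` _ = A) //; apply/seteqP; split=> y; [case=> // ->|left].
have /choice[g gP] : forall y, exists z,
    (y = x -> z = f 0%N) /\
    (forall n, y = f n -> z = f n.+1) /\
    ((y <> x /\ forall n, y <> f n) -> z = y).
  move=> y; have [->|yx] := pselect (y = x).
    exists (f 0%N); split=> //; split=> [n xf|[]//].
    by case: nAx; rewrite xf; exact: fA.
  have [[n yf]|nf] := pselect (exists n, y = f n).
    exists (f n.+1); split=> //; split=> [m|[_ /(_ n)]//].
    by rewrite yf => /(finj _ _ I I) ->.
  by exists y; split=> //; split=> // n yf; case: nf; exists n.
apply: (@card_leI _ _ _ _ g) => [y|y z]; have [gy1 [gy2 gy3]] := gP y.
  case=> [Ay|->]; last by have [-> // _] := gP x; exact: fA.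
  have [yx|yx] := pselect (y = x); first by rewrite gy1 //; exact: fA.
  have [[n yf]|nf] := pselect (exists n, y = f n); first by rewrite (gy2 _ yf); exact: fA.
  by rewrite gy3 //; split=> // n yf; case: nf; exists n.
move=> _ _; have [gz1 [gz2 gz3]] := gP z.
have cases w : w = x \/ (exists n, w = f n) \/ (w <> x /\ forall n, w <> f n).
  have [wx|wx] := pselect (w = x); first by left.
  have [[n wf]|nf] := pselect (exists n, w = f n); first by right; left; exists n.
  by right; right; split=> // n wf; case: nf; exists n.
have [yx|[[n yf]|ny]] := cases y; have [zx|[[m zf]|nz]] := cases z.
- by rewrite yx zx.
- by rewrite (gy1 yx) (gz2 _ zf) => /(finj _ _ I I).
- by rewrite (gy1 yx) (gz3 nz) => e; case: nz => _ /(_ 0%N); rewrite e.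
- by rewrite (gz1 zx) (gy2 _ yf) => /(finj _ _ I I).
- by rewrite (gy2 _ yf) (gz2 _ zf) yf zf => /(finj _ _ I I) [->].
- by rewrite (gy2 _ yf) (gz3 nz) => e; case: nz => _ /(_ n.+1); rewrite e.
- by rewrite (gz1 zx) (gy3 ny) => e; case: ny => _ /(_ 0%N); rewrite e.
- by rewrite (gz2 _ zf) (gy3 ny) => e; case: ny => _ /(_ m.+1); rewrite e.
- by rewrite (gy3 ny) (gz3 nz).
Qed.

(** * Strict well-orders and recursion along them *)

Record strict_well_order T (lt : T -> T -> Prop) : Prop := {
  swo_wf : well_founded lt;
  swo_trans : forall y x z, lt x y -> lt y z -> lt x z;
  swo_total : forall x y, x = y \/ (lt x y \/ lt y x) }.

Lemma swo_of_well_order (T : Type) (R : rel T) : wochoice.well_order R ->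
  strict_well_order (fun x y => R x y /\ x <> y).
Proof.
move=> woR.
have least (A : set T) x : A x -> exists m, [/\ A m, forall y, A y -> R m y &
    forall m', A m' -> (forall y, A y -> R m' y) -> m = m'].
  move=> Ax; have [|m [[Am lem] um]] := woR (fun y => `[<A y>]).
    by exists x; rewrite unfold_in; apply/asboolP.
  exists m; split=> [|y Ay|m' Am' lem'].
  - exact/asboolP.
  - by apply: lem; rewrite unfold_in; apply/asboolP.
  - apply: um; split; first by rewrite unfold_in; apply/asboolP.
    by move=> y /asboolP Ay; exact: lem'.
(* Both [x] and [y] are least in the pair, and least elements are unique. *)
have anti x y : R x y -> R y x -> x = y.
  move=> xy yx; have refl z : R z z.
    by have [m [-> le _]] := least [set z] z erefl; exact: le.
  have [m [_ _ u]] := least [set x; y] x (or_introl erefl).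
  by rewrite -(u x) ?(u y) //; [right|move=> z [->|->]|left|move=> z [->|->]].
split.
- move=> x; apply: contrapT => nx.
  have [m [nm lem _]] := least [set z | ~ Acc (fun x y => R x y /\ x <> y) z] x nx.
  apply: nm; constructor => y [ym nym]; apply: contrapT => /lem my.
  exact/nym/anti.
- move=> y x z [xy nxy] [yz nyz]; split; last first.
    by move=> xz; apply: nxy; apply: anti => //; rewrite xz.
  have [m [Am le _]] := least [set u | u = x \/ u = y \/ u = z] x (or_introl erefl).
  case: Am => [mx|[my|mz]].
  + by rewrite -mx; apply: le; right; right.
  + by case: nxy; apply: anti => //; rewrite -my; apply: le; left.
  + by case: nyz; apply: anti => //; rewrite -mz; apply: le; right; left.
- move=> x y; have [->|nxy] := pselect (x = y); [by left|right].
  have [m [[mx|my] le _]] := least [set x; y] x (or_introl erefl).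
    by left; split=> //; rewrite -mx; apply: le; right.
  by right; split=> [|/esym//]; rewrite -my; apply: le; left.
Qed.

Lemma exists_strict_well_order (T : Type) : exists lt : T -> T -> Prop, strict_well_order lt.
Proof.
elim/Peq: T => T; have [R woR] := well_ordering_principle T.
by exists (fun x y => R x y /\ x <> y); exact: swo_of_well_order.
Qed.

Section StrictWellOrder.
Variables (T : Type) (lt : T -> T -> Prop).
Hypothesis wo : strict_well_order lt.

Lemma swo_irr x : ~ lt x x.
Proof.
by move=> xx; elim: (swo_wf wo x) xx => y _ IH yy; exact: (IH y yy).
Qed.

Lemma swo_least (P : T -> Prop) x : P x -> exists2 m, P m & forall y, P y -> ~ lt y m.
Proof.
elim: (swo_wf wo x) => {}x _ IH Px.
have [[y yx Py]|nP] := pselect (exists2 y, lt y x & P y); first exact: IH yx Py.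
by exists x => // y Py yx; apply: nP; exists y.
Qed.

Lemma swo_le x y : ~ lt y x -> x = y \/ lt x y.
Proof. by have [->|[]] := swo_total wo x y; [left|right|]. Qed.

Lemma swo_lt_le y x z : lt x y -> ~ lt z y -> lt x z.
Proof. by move=> xy /swo_le[<-//|yz]; exact: (swo_trans wo xy yz). Qed.

Lemma swo_le_lt y x z : ~ lt y x -> lt y z -> lt x z.
Proof. by move=> /swo_le[->//|xy] yz; exact: (swo_trans wo xy yz). Qed.

Lemma swo_le_trans y x z : ~ lt y x -> ~ lt z y -> ~ lt z x.
Proof. by move=> yx zy zx; apply: zy; exact: swo_lt_le zx yx. Qed.

Lemma swo_asym x y : lt x y -> ~ lt y x.
Proof. by move=> xy yx; exact: swo_irr (swo_trans wo xy yx). Qed.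

Lemma swo_le_anti x y : ~ lt y x -> ~ lt x y -> x = y.
Proof. by have [->|[]] := swo_total wo x y. Qed.

(** Recursion with a choice at each step. The second hypothesis says that [P] sees [g] only below
    [n], so the default [y0] taken elsewhere is harmless. *)
Lemma swo_rec_choice (Y : Type) (y0 : Y) (P : T -> (T -> Y) -> Y -> Prop) :
  (forall n g, exists y, P n g y) ->
  (forall n g g' y, (forall m, lt m n -> g m = g' m) -> P n g y -> P n g' y) ->
  exists s : T -> Y, forall n, P n s (s n).
Proof.
move=> /(_ _)/choice-/all_tag[F FP] Pext.
pose ext n (g : forall m, lt m n -> Y) m :=
  if pselect (lt m n) is left mn then g m mn else y0.
pose s := Fix (swo_wf wo) (fun=> Y) (fun n g => F n (@ext n g)).
have sE n : s n = F n (@ext n (fun m _ => s m)).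
  rewrite /s Fix_eq // => x f g fg; congr (F x _); apply: funext => m.
  by rewrite /ext; case: pselect.
exists s => n; rewrite sE; apply: Pext (FP n _) => m mn.
by rewrite /ext; case: pselect.
Qed.

Definition seg x := [set y | lt y x].

End StrictWellOrder.

Lemma lexi_swo (U V : Type) (ltU : U -> U -> Prop) (ltV : V -> V -> Prop) :
  strict_well_order ltU -> strict_well_order ltV ->
  strict_well_order (fun a b : U * V => ltU a.1 b.1 \/ (a.1 = b.1 /\ ltV a.2 b.2)).
Proof.
move=> woU woV; split.
- move=> [u v]; elim: (swo_wf woU u) v => {}u _ IHu v.
  elim: (swo_wf woV v) => {}v _ IHv; constructor => -[u' v'] /=.
  by case=> [/IHu//|[-> /IHv]].
- move=> [u v] [u' v'] [u'' v''] /= [h|[-> h]] [k|[<- k]].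
  + by left; exact: (swo_trans woU h k).
  + by left.
  + by left.
  + by right; split=> //; exact: (swo_trans woV h k).
- move=> [u v] [u' v'] /=.
  have [->|[h|h]] := swo_total woU u u'; last 2 first.
  + by right; left; left.
  + by right; right; left.
  have [->|[h|h]] := swo_total woV v v'; first by left.
  + by right; left; right.
  + by right; right; right.
Qed.

Lemma preimage_swo (U V : Type) (lt' : V -> V -> Prop) (f : U -> V) : injective f ->
  strict_well_order lt' -> strict_well_order (fun x y => lt' (f x) (f y)).
Proof.
move=> finj wo'; split.
- move=> x; move: {2}(f x) (erefl (f x)) => v.
  elim: (swo_wf wo' v) x => {}v _ IH x xv.
  constructor => y; rewrite xv => yv; exact: (IH (f y) yv y erefl).
- by move=> y x z; exact: (swo_trans wo').
- by move=> x y; have [/finj->|] := swo_total wo' (f x) (f y); [left|right].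
Qed.

Lemma nat_swo : strict_well_order (fun m n : nat => (m < n)%N).
Proof.
split=> [n|y x z|x y]; last 2 first.
- exact: ltn_trans.
- by have [xy|yx|->] := ltngtP x y; [right; left|right; right|left].
elim: n {-2}n (leqnn n) => [|n IH] m mn; constructor => k km.
  by move: (leq_trans km mn).
by apply: IH; rewrite -ltnS; exact: leq_trans km mn.
Qed.

(** * Squares of infinite cardinals *)

Section SquareCardinal.
Variables (T : Type) (lt : T -> T -> Prop).
Hypothesis wo : strict_well_order lt.

Let maxt a b := if pselect (lt a b) is left _ then b else a.

Let maxt_le a b : ~ lt (maxt a b) a /\ ~ lt (maxt a b) b.
Proof.
rewrite /maxt; case: pselect => [ab|nab]; split=> //; try exact: swo_irr.
exact: swo_asym.
Qed.

Let godel (a b : T * T) :=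
  lt (maxt a.1 a.2) (maxt b.1 b.2) \/
  (maxt a.1 a.2 = maxt b.1 b.2 /\ (lt a.1 b.1 \/ (a.1 = b.1 /\ lt a.2 b.2))).

Let godel_swo : strict_well_order godel.
Proof.
have := @preimage_swo _ _ _ (fun a : T * T => (maxt a.1 a.2, a)) _
  (lexi_swo wo (lexi_swo wo wo)).
by apply=> x y [].
Qed.

(* An injection of [S * S] into [S] sends each pair to an element of [S] not yet
   used on its predecessors in Goedel's ordering of the pairs. *)
Let square_downset (S : set T) :
  (forall x y, S x -> lt y x -> S y) ->
  (forall x, S x -> infinite_set (seg lt x) -> seg lt x `*` seg lt x #<= seg lt x) ->
  (forall x, S x -> ~ (S #<= seg lt x)) ->
  infinite_set S -> S `*` S #<= S.
Proof.
move=> Sdown IH Sinit Sinf.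
have [t0 _] := infinite_setN0 Sinf.
(* In Goedel's ordering the predecessors of a pair lie in the square of a closed initial segment,
   which is too small to map onto [S]. *)
have small x : S x -> ~ (S #<= (seg lt x `|` [set x]) `*` (seg lt x `|` [set x])).
  move=> Sx Sle; have [fin|inf] := pselect (finite_set (seg lt x)).
    apply: Sinf; apply: card_le_finite Sle _.
    by apply: finite_setX; rewrite finite_setU; split=> //; exact: finite_set1.
  apply: (Sinit x Sx); apply: card_le_trans Sle _.
  apply: (card_le_trans (card_le_setX _ _)); last exact: IH Sx inf.
    exact: infinite_add1.
  exact: infinite_add1.
have [p g|p g g' y gg' pgy S2p|s sP] := swo_rec_choice godel_swo t0
    (P := fun p g y => (S `*` S) p -> S y /\ forall q, godel q p -> (S `*` S) q -> g q <> y).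
- have [Sp|] := pselect ((S `*` S) p); last by exists t0.
  apply: contrapT => /forallNP nex.
  have Sm : S (maxt p.1 p.2) by rewrite /maxt; case: pselect => _; case: Sp.
  apply: (small _ Sm); apply: (card_le_surj (f := g)) => y Sy.
  have /not_implyP[_ /not_andP[//|/existsNP[q /not_implyP[qp /not_implyP[Sq /contrapT gq]]]]] := nex y.
  exists q => //.
  have mq : ~ lt (maxt p.1 p.2) (maxt q.1 q.2).
    by case: qp => [/(swo_asym wo)//|[-> _]]; exact: swo_irr.
  have [q1 q2] := maxt_le q.1 q.2.
  by split; [have := swo_le_trans wo q1 mq|have := swo_le_trans wo q2 mq];
     case/(swo_le wo) => [->|]; by [right|left].
- have [Sy pgy'] := pgy S2p; split=> // q qp Sq; rewrite -gg' //; exact: pgy'.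
apply: (@card_leI _ _ _ _ s) => [p /sP[]//|p q Sp Sq spq].
have [//|[pq|qp]] := swo_total godel_swo p q.
- by have [_ /(_ p pq Sp)] := sP q Sq.
- by have [_ /(_ q qp Sq)] := sP p Sp; rewrite spq.
Qed.

Let square_seg x : infinite_set (seg lt x) -> seg lt x `*` seg lt x #<= seg lt x.
Proof.
elim: (swo_wf wo x) => {}x _ IH inf.
(* Either a shorter segment has the same cardinality and induction applies, or [seg lt x] is an
   initial ordinal. *)
have [[y yx xy]|nini] := pselect (exists2 y, lt y x & seg lt x #<= seg lt y).
  have infy : infinite_set (seg lt y) by move=> /(card_le_finite xy).
  apply: (card_le_trans (card_le_setX xy xy)).
  apply: (card_le_trans (IH y yx infy)); apply: subset_card_le => z zy.
  exact: (swo_trans wo zy yx).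
apply: square_downset => //.
- by move=> y z yx zy; exact: (swo_trans wo zy yx).
- by move=> y yx xy; apply: nini; exists y.
Qed.

Lemma card_setX_diag : infinite_set [set: T] -> [set: T] `*` [set: T] #<= [set: T].
Proof.
move=> inf; have [[y Ty]|nini] := pselect (exists y, [set: T] #<= seg lt y).
  have infy : infinite_set (seg lt y) by move=> /(card_le_finite Ty).
  apply: (card_le_trans (card_le_setX Ty Ty)).
  by apply: (card_le_trans (square_seg infy)); exact: subset_card_le.
apply: square_downset => //; first by move=> x _; exact: square_seg.
by move=> x _ Tx; apply: nini; exists x.
Qed.

End SquareCardinal.

Lemma card_setX_square T U V (A : set U) (B : set V) : infinite_set [set: T] ->
  A #<= [set: T] -> B #<= [set: T] -> A `*` B #<= [set: T].
Proof.
move=> inf AT BT; have [lt wo] := exists_strict_well_order T.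
exact: card_le_trans (card_le_setX AT BT) (card_setX_diag wo inf).
Qed.

Lemma card_prod_le T U V : infinite_set [set: T] ->
  [set: U] #<= [set: T] -> [set: V] #<= [set: T] -> [set: U * V] #<= [set: T].
Proof.
move=> inf UT VT; apply: card_le_trans (card_setX_square inf UT VT).
exact: subset_card_le.
Qed.

(** * Club guessing *)

Section ClubGuessing.
Variables (L M N : Type) (lt : L -> L -> Prop) (ltN : N -> N -> Prop).
Hypothesis wo : strict_well_order lt.
Hypothesis woN : strict_well_order ltN.
Hypothesis Minf : infinite_set [set: M].
Hypothesis NM : [set: N] #<= [set: M].
Hypothesis Lunc : ~ ([set: L] #<= [set: nat]).
Hypothesis Linit : forall x, ~ ([set: L] #<= seg lt x).
Hypothesis Lreg : forall (K : Type) (D : set K) (f : K -> L),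
  ~ ([set: L] #<= D) -> exists x, forall k, D k -> lt (f k) x.

(* The points closed under [r] form a club, and every club contains one of this form. *)
Definition closed_at (r : L -> L) (a : L) := forall x, lt x a -> lt (r x) a.

Lemma bound2 a b : exists2 c, lt a c & lt b c.
Proof.
have [|c cP] := Lreg (D := [set: bool]) (fun d => if d then a else b).
  by move=> /card_le_trans h; apply: Lunc; apply: h; exact: countableP.
by exists c; [exact: (cP true)|exact: (cP false)].
Qed.

Lemma bound_seg (f : L -> L) a : exists b, forall x, ~ lt a x -> lt (f x) b.
Proof.
have [c cP] := Lreg f (Linit (x := a)); have [b cb fab] := bound2 c (f a).
exists b => x /(swo_le wo)[->//|xa]; exact: (swo_trans wo (cP x xa)).
Qed.

(** Reduces closure under a binary operation to closure under a unary one: apply [r] to the larger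
    argument. *)
Lemma bound_seg2 (F : L -> L -> L) :
  exists r : L -> L, forall a x y, ~ lt a x -> ~ lt a y -> lt (F x y) (r a).
Proof.
have /choice[g gP] a : exists g : L -> L, forall x y, ~ lt a y -> lt (F x y) (g x).
  have /choice[g gP] x := bound_seg (F x) a.
  by exists g.
have /choice[r rP] a := bound_seg (g a) a.
by exists r => a x y ax ay; exact: (swo_trans wo (gP a x y ay) (rP a x ax)).
Qed.

(** The supremum of the iterates of [F] from [c] works: countable families are bounded, and each
    point below the supremum is at or below some iterate. *)
Lemma closed_at_unbounded r c : exists2 a, closed_at r a & lt c a.
Proof.
have /choice[F FP] a : exists b, lt a b /\ forall x, ~ lt a x -> lt (r x) b.
  have [b bP] := bound_seg r a; have [d ad bd] := bound2 a b.
  by exists d; split=> // x /bP rx; exact: (swo_trans wo rx bd).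
pose s n := iter n F c.
have [a0 a0P] := Lreg (D := [set: nat]) s Lunc.
have [a aP amin] := swo_least wo (P := fun a => forall n, lt (s n) a)
  (fun n => a0P n I).
exists a; last exact: (aP 0%N).
move=> x xa; have [n nsx] : exists n, ~ lt (s n) x.
  by apply: contrapT => /forallNP nx; apply: (amin x) => // n; apply: contrapT.
have [_ /(_ x nsx) rx] := FP (s n); exact: (swo_trans wo rx (aP n.+1)).
Qed.

Definition is_floor (E : set L) x u :=
  [/\ E u, ~ lt x u & forall e, E e -> ~ lt x e -> ~ lt u e].

Lemma is_floor_unique E x u v : is_floor E x u -> is_floor E x v -> u = v.
Proof.
by move=> [Eu ux mu] [Ev vx mv]; apply: (swo_le_anti wo); [exact: mv|exact: mu].
Qed.

Definition common_closed (rs : L -> L -> L) (z : L) : set L :=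
  [set a | forall x, lt x z -> closed_at (rs x) a].

(** The supremum of the common closed points up to [x] is again closed; if there are none, it is the
    least point of [L], closed vacuously. *)
Lemma is_floor_ex rs z x : exists u, is_floor (common_closed rs z) x u.
Proof.
have [m mP mmin] := swo_least wo (x := x)
  (P := fun u => forall e, common_closed rs z e -> ~ lt x e -> ~ lt u e) (fun _ _ h => h).
exists m; split=> //; last by apply: mmin.
move=> t tz y ym.
have [e [Ee xe ye]] : exists e, [/\ common_closed rs z e, ~ lt x e & lt y e].
  apply: contrapT => /forallNP ne; apply: (mmin y) => // e Ee xe ye.
  by apply: (ne e).
exact: (swo_lt_le wo (Ee t tz y ye) (mP e Ee xe)).
Qed.

Section Guess.
(* [xs] plays the role of the ordinal [M^+] inside [L]. *)
Variable xs : L.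
Hypothesis xsM : ~ (seg lt xs #<= [set: M]).
Hypothesis ltxsM : forall x, lt x xs -> seg lt x #<= [set: M].

(** Regularity of a successor cardinal: were the family unbounded, the segment below [xs] would be a
    union of at most [M] segments of size at most [M]. *)
Lemma bound_small (K : Type) (D : set K) (f : K -> L) : D #<= [set: M] ->
  (forall k, D k -> lt (f k) xs) -> exists2 w, lt w xs & forall k, D k -> ~ lt w (f k).
Proof.
move=> DM fxs; apply: contrapT => nex; have [m0 _] := infinite_setN0 Minf.
have big w : exists k, lt w xs -> D k /\ lt w (f k).
  have [wxs|nw] := pselect (lt w xs).
    apply: contrapT => /forallNP nk; apply: nex; exists w => // k Dk wk.
    by apply: (nk k).
  have [k0 _] : exists k : K, True.
    apply: contrapT => /forallNP nk; have [x] : exists x, lt x xs.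
      by apply: contrapT => /forallNP nx; apply: xsM; apply: (card_leI (f := fun=> m0)) => [//|x y /nx].
    by move=> xxs; apply: nex; exists x => // k; case: (nk k).
  by exists k0.
have {big}[k kP] := choice big.
have /choice[i iP] v : exists i : L -> M, lt v xs ->
    forall x y, lt x v -> lt y v -> i x = i y -> x = y.
  have [vxs|nv] := pselect (lt v xs); last by exists (fun=> m0).
  by have [i [_ iinj]] := card_leE m0 (ltxsM vxs); exists i.
apply: xsM; apply: (@card_le_trans _ (K * M)%type _ (D `*` [set: M])); last first.
  exact: card_setX_square.
(* [w] is coded by an index whose value exceeds it and by its place in the segment below that
   value. *)
apply: (card_leI (f := fun w => (k w, i (f (k w)) w))) => [w /kP[]//|w w' wxs w'xs].
case=> kk; have [Dk wk] := kP w wxs; have [Dk' wk'] := kP w' w'xs.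
by rewrite -kk in wk' *; apply: (iP _ (fxs _ Dk)).
Qed.

Lemma xs_limit x : lt x xs -> exists2 y, lt y xs & lt x y.
Proof.
move=> xxs; apply: contrapT => ny; apply: xsM.
have sub : seg lt xs `<=` seg lt x `|` [set x].
  move=> y yxs; have /(swo_le wo)[->|] : ~ lt x y by move=> xy; apply: ny; exists y.
    by right.
  by left.
apply: (card_le_trans (subset_card_le sub)).
have [fin|inf] := pselect (finite_set (seg lt x)).
  apply: (@card_le_trans _ _ _ [set: nat]); last exact/infiniteP.
  apply: finite_set_countable; rewrite finite_setU; split=> //; exact: finite_set1.
exact: (card_le_trans (infinite_add1 _ inf) (ltxsM xxs)).
Qed.

Lemma xs_max x y : lt x xs -> lt y xs -> exists z, [/\ lt z xs, ~ lt z x & ~ lt z y].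
Proof.
move=> xxs yxs; have [xy|yx] := pselect (lt x y).
  by exists y; split=> //; [exact: swo_asym|exact: swo_irr].
by exists x; split=> //; exact: swo_irr.
Qed.

Let ladder d (c : L -> L) :=
  [/\ forall i i', lt i i' -> lt i' xs -> lt (c i) (c i'),
      forall i, lt i xs -> lt (c i) d &
      forall y, lt y d -> exists2 i, lt i xs & ~ lt (c i) y].

(* Shelah's argument: if every candidate family fails, iterate along [xs] the
   clubs witnessing the failures; the projection of a point of a ladder onto these
   decreasing clubs never increases, hence is eventually constant, and a stage at
   which boundedly many points of the ladder have stabilised did guess correctly. *)
Lemma club_guessing : exists C : L -> L -> N -> L, forall r : L -> L, exists d j,
  (forall n, closed_at r (C d j n)) /\ (forall m n, ltN m n -> lt (C d j m) (C d j n)).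
Proof.
have /choice[c cP] d : exists c, (exists c', ladder d c') -> ladder d c.
  have [[c cl]|nc] := pselect (exists c', ladder d c'); first by exists c.
  by exists id.
(* The bound [j] matters: only boundedly many ladder points can be asked to have stabilised at a
   common stage. *)
pose good (E : set L) d j (s : N -> L) := (forall m n, ltN m n -> lt (s m) (s n)) /\
  forall n, exists i, ~ lt j i /\ is_floor E (c d i) (s n).
apply: contrapT => /forallNP noC.
have [l0 _] : exists x : L, True.
  apply: contrapT => /forallNP nL; apply: Lunc.
  by apply: (card_leI (f := fun=> 0%N)) => // x; case: (nL x).
(* The family of good sequences chosen for [E] misses some club; [Rr E] is a function defining that
   club. *)
have /choice[Rr RrP] (E : set L) : exists r, forall d j, (exists s, good E d j s) ->
    exists s, good E d j s /\ exists n, ~ closed_at r (s n).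
  have /choice[C CP] (dj : L * L) : exists s,
      (exists s', good E dj.1 dj.2 s') -> good E dj.1 dj.2 s.
    have [[s gs]|ns] := pselect (exists s', good E dj.1 dj.2 s'); first by exists s.
    by exists (fun=> l0).
  have /existsNP[r /forallNP rP] := noC (fun d j => C (d, j)).
  exists r => d j /(CP (d, j)) gs; exists (C (d, j)); split=> //.
  apply/existsNP => rs; move/forallNP/(_ j): (rP d); apply; split=> //.
  by case: gs.
(* [rs z] defeats the family built on the points closed under all earlier [rs x]. *)
have [z g|z g g' y gg' ->|rs rsP] := swo_rec_choice wo (fun=> l0)
    (P := fun z g y => y = Rr (common_closed g z)).
- by eexists.
- congr Rr; apply/seteqP; split=> a ga x xz; first by rewrite -gg' //; exact: ga.
  by rewrite gg' //; exact: ga.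
pose E := common_closed rs.
have Emono z z' : ~ lt z' z -> E z' `<=` E z.
  by move=> zz' a Ea x xz; apply: Ea; exact: (swo_lt_le wo xz zz').
(* [rinf] dominates [rs z] for all [z] below [xs], so a point closed under it lies in each of these
   [E z]. *)
have /choice[rinf rinfP] x := Lreg (fun z => rs z x) (Linit (x := xs)).
have [z g|z g g' y gg' [yc yg]|e eP] := swo_rec_choice wo l0
    (P := fun z g y => closed_at rinf y /\ forall x, lt x z -> lt (g x) y).
- have [b bP] := Lreg g (Linit (x := z)).
  have [a ac ba] := closed_at_unbounded rinf b.
  by exists a; split=> // x xz; exact: (swo_trans wo (bP x xz) ba).
- by split=> // x xz; rewrite -gg' //; exact: yg.
(* The supremum [d] of the first [xs] values of [e] has a ladder, since [e] is one. *)
have [d0 d0P] := Lreg e (Linit (x := xs)).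
have [d dP dmin] := swo_least wo (P := fun d => forall x, lt x xs -> lt (e x) d) d0P.
have elad y : lt y d -> exists2 i, lt i xs & ~ lt (e i) y.
  move=> yd; apply: contrapT => ni; apply: (dmin y) => // x xxs.
  by apply: contrapT => nxy; apply: ni; exists x.
have [cinc cd ccof] : ladder d (c d).
  apply: cP; exists e; split=> // i i' ii' _; exact: (eP i').2.
have eE z x : lt z xs -> E z (e x).
  move=> zxs t tz y ye.
  have /rinfP h := swo_trans wo tz zxs.
  by apply: (swo_trans wo (h y)); exact: (eP x).1.
have [z0 z0xs] : exists z, lt z xs.
  apply: contrapT => /forallNP nx; apply: xsM; have [m0 _] := infinite_setN0 Minf.
  by apply: (card_leI (f := fun=> m0)) => [//|x y /nx].
(* As the clubs shrink, the projection of [c d i] can only move down; its least value [q i] is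
   reached at a stage [zz i] and kept from then on. *)
have /choice[qz qzP] i : exists qz : L * L, lt qz.2 xs /\
    forall z, lt z xs -> ~ lt z qz.2 -> is_floor (E z) (c d i) qz.1.
  have [u0 u0P] := is_floor_ex rs z0 (c d i).
  have [u [zi [zixs ziu]] umin] := swo_least wo (x := u0)
    (P := fun u => exists z, lt z xs /\ is_floor (E z) (c d i) u)
    (ex_intro _ z0 (conj z0xs u0P)).
  exists (u, zi); split=> // z zxs /= ziz; have [v vP] := is_floor_ex rs z (c d i).
  suff -> : u = v by [].
  apply: (swo_le_anti wo); last first.
    case: vP ziu => Ev cv _ [_ _]; apply=> //; exact: Emono Ev.
  by apply: umin; exists z.
pose q i := (qz i).1; pose zz i := (qz i).2.
have zxs i : lt (zz i) xs by case: (qzP i).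
have qP i z : lt z xs -> ~ lt z (zz i) -> is_floor (E z) (c d i) (q i).
  by case: (qzP i) => _; exact.
have qc i : ~ lt (c d i) (q i).
  by have [] := qP i (zz i) (zxs i) (swo_irr wo (x := zz i)).
have qd i : lt i xs -> lt (q i) d by move=> ixs; exact: (swo_le_lt wo (qc i) (cd i ixs)).
have qmono i i' : lt i' xs -> ~ lt i' i -> ~ lt (q i') (q i).
  move=> i'xs /(swo_le wo)[->|ii']; first exact: swo_irr.
  have [z [zx zi zi']] := xs_max (zxs i) (zxs i').
  have [Eq cq _] := qP i z zx zi; have [_ _ max'] := qP i' z zx zi'.
  apply: max' => //; apply: (swo_le_trans wo cq); exact/(swo_asym wo)/cinc.
(* [e x'] lies in all these clubs, so projections of ladder points beyond it never drop below it. *)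
have qcof y : lt y d -> exists2 i, lt i xs & lt y (q i).
  move=> /elad[x xxs exy]; have [x' x'xs xx'] := xs_limit xxs.
  have yx' : lt y (e x') by apply: (swo_le_lt wo exy); exact: (eP x').2.
  have [i ixs cex'] := ccof _ (dP x' x'xs); exists i => //.
  apply: (swo_lt_le wo yx').
  have [_ _ max] := qP i (zz i) (zxs i) (swo_irr wo (x := zz i)).
  by apply: max => //; exact: eE.
(* Thin out the ladder so that [q] increases strictly; [xs] is never exhausted because [N] is at
   most [M]. *)
have [n g|n g g' i gg' Pi g'xs|s sP] := swo_rec_choice woN l0
    (P := fun n g i => (forall m, ltN m n -> lt (g m) xs) ->
       lt i xs /\ forall m, ltN m n -> lt (q (g m)) (q i)).
- have [gxs|] := pselect (forall m, ltN m n -> lt (g m) xs); last by exists l0.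
  have [w wxs wP] : exists2 w, lt w xs & forall m, ltN m n -> ~ lt w (g m).
    apply: (bound_small (D := seg ltN n)) => //.
    exact: card_le_trans (card_leT _) NM.
  have [i ixs wi] := qcof _ (qd w wxs); exists i => _; split=> // m mn.
  by apply: (swo_le_lt wo _ wi); apply: qmono => //; exact: wP.
- have [|ixs gi] := Pi; first by move=> m mn; rewrite gg' //; exact: g'xs.
  by split=> // m mn; rewrite -gg' //; exact: gi.
have sxs n : lt (s n) xs.
  by elim: (swo_wf woN n) => {}n _ IH; case: (sP n).
have sinc m n : ltN m n -> lt (q (s m)) (q (s n)).
  by move=> mn; have [_] := sP n (fun m _ => sxs m); apply.
(* [j] bounds the chosen indices, and by stage [zs] all ladder points of index up to [j] have
   stabilised. *)
have [j jxs jP] := bound_small (D := [set: N]) (f := s) NM (fun n _ => sxs n).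
have [w wxs wP] := bound_small (D := seg lt j) (f := zz) (ltxsM jxs) (fun n _ => zxs n).
have [zs [zsxs zsw zsj]] := xs_max wxs (zxs j).
have zsP i : ~ lt j i -> ~ lt zs (zz i).
  move=> /(swo_le wo)[->//|/wP wi]; exact: (swo_le_trans wo wi zsw).
have [|s' [[_ s'P] [n]]] := RrP (E zs) d j.
  exists (q \o s); split=> [m n /sinc//|n]; exists (s n).
  by split; [exact: jP|apply: qP => //; exact/zsP/jP].
rewrite -/(common_closed rs zs) -rsP; apply.
have [i [ij pis']] := s'P n.
have zxs' := zsP i ij.
rewrite (is_floor_unique pis' (qP i zs zsxs zxs')).
(* The stable value also lies in a later club, hence is closed under [rs zs], against the choice of
   [Rr (E zs)]. *)
have [z' z'xs zsz'] := xs_limit zsxs.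
have [Ez' _ _] := qP i z' z'xs (swo_le_trans wo zxs' (swo_asym wo zsz')).
exact: Ez'.
Qed.

End Guess.
End ClubGuessing.

(** * Generated subgroups and the number of finite lists *)

Section GeneratedSubgroup.
Variables (V : zmodType) (Y : Type) (g : Y -> V).
Local Open Scope ring_scope.

(** Presents the elements of the generated subgroup by lists, which bounds their number. *)
Definition signed_sum (s : seq (bool * Y)) : V :=
  \sum_(b <- s) (if b.1 then g b.2 else - g b.2).

Definition span : {pred V} := fun u => `[< exists s, u = signed_sum s >].

Fact span_zmod_closed : zmod_closed span.
Proof.
split=> [|u v /asboolP[s ->] /asboolP[t ->]]; apply/asboolP.
  by exists [::]; rewrite /signed_sum big_nil.
exists (s ++ [seq (~~ b.1, b.2) | b <- t]).
rewrite /signed_sum big_cat big_map /= -GRing.sumrN; congr (_ + _).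
by apply: eq_bigr => -[[] y] _ //=; rewrite GRing.opprK.
Qed.
HB.instance Definition _ := GRing.isZmodClosed.Build V span span_zmod_closed.

Record spanned := Spanned { spanned_val : V; _ : spanned_val \in span }.
HB.instance Definition _ := [isSub for spanned_val].
HB.instance Definition _ := [Choice of spanned by <:].
HB.instance Definition _ := [SubChoice_isSubZmodule of spanned by <:].

Lemma mem_span y : g y \in span.
Proof. by apply/asboolP; exists [:: (true, y)]; rewrite /signed_sum big_seq1. Qed.

Definition spanned_gen y : spanned := Spanned (mem_span y).

Lemma spanned_ind (P : V -> Prop) : P 0 -> (forall y, P (g y)) -> (forall u, P u -> P (- u)) ->
  (forall u v, P u -> P v -> P (u + v)) -> forall a : spanned, P (val a).
Proof.
move=> P0 Pg PN PD [u uS] /=; case/asboolP: (uS) => s -> {uS}; elim: s => [|[b y] s IH].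
  by rewrite /signed_sum big_nil.
by rewrite /signed_sum big_cons; apply: PD => //; case: b => /=; [|apply: PN].
Qed.

End GeneratedSubgroup.

(** The length is part of the code because lists of different lengths may fold to the same value. *)
Lemma card_seq_le X T : infinite_set [set: T] -> [set: X] #<= [set: T] ->
  [set: seq X] #<= [set: T].
Proof.
move=> inf XT; have [t0 _] := infinite_setN0 inf.
have [e [_ einj]] := card_leE t0 XT.
have [pr [_ prinj]] := card_leE t0 (card_setX_square inf (card_lexx [set: T]) (card_lexx [set: T])).
have [nt [_ ntinj]] := card_leE t0 ((infiniteP _).1 inf).
pose code := foldr (fun x t => pr (e x, t)) t0.
have codeinj s s' : size s = size s' -> code s = code s' -> s = s'.
  elim: s s' => [|x s IH] [|x' s'] //= [/IH{}IH] /prinj-/(_ (conj I I) (conj I I))[ex /IH->].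
  by rewrite (einj _ _ I I ex).
apply: (card_leI (f := fun s => pr (nt (size s), code s))) => // s s' _ _.
by move=> /prinj-/(_ (conj I I) (conj I I))[/(ntinj _ _ I I) es ec]; exact: codeinj.
Qed.

(** * Products of finite cyclic groups *)

Section CyclicProduct.
Variables (p : nat) (X : Type).
Local Open Scope ring_scope.

(** Exponents start at 1, so that for prime [p] every modulus exceeds 1 and ['Z_] has exactly that
    order. *)
Definition cyc_prod := forall b : X * nat, 'Z_(p ^ b.2.+1).
HB.instance Definition _ := Choice.on cyc_prod.

Fact cyc_addA : associative (fun (u v : cyc_prod) b => u b + v b).
Proof. by move=> u v w; apply: functional_extensionality_dep => b; rewrite GRing.addrA. Qed.
Fact cyc_addC : commutative (fun (u v : cyc_prod) b => u b + v b).
Proof. by move=> u v; apply: functional_extensionality_dep => b; rewrite GRing.addrC. Qed.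
Fact cyc_add0 : left_id (fun b => 0) (fun (u v : cyc_prod) b => u b + v b).
Proof. by move=> u; apply: functional_extensionality_dep => b; rewrite GRing.add0r. Qed.
Fact cyc_addN : left_inverse (fun b => 0) (fun (u : cyc_prod) b => - u b) (fun u v b => u b + v b).
Proof. by move=> u; apply: functional_extensionality_dep => b; rewrite GRing.addNr. Qed.
HB.instance Definition _ := GRing.isZmodule.Build cyc_prod cyc_addA cyc_addC cyc_add0 cyc_addN.

Lemma cyc_eq (u v : cyc_prod) : (forall b, u b = v b) -> u = v.
Proof. exact: functional_extensionality_dep. Qed.

Lemma cyc_addE (u v : cyc_prod) b : (u + v) b = u b + v b. Proof. by []. Qed.
Lemma cyc_oppE (u : cyc_prod) b : (- u) b = - u b. Proof. by []. Qed.
Lemma cyc_zeroE b : (0 : cyc_prod) b = 0. Proof. by []. Qed.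
Lemma cyc_mulrnE (u : cyc_prod) n b : (u *+ n) b = u b *+ n.
Proof. by elim: n => // n IH; rewrite !GRing.mulrS cyc_addE IH. Qed.

Hypothesis pp : prime p.

Lemma mulrn_cyc k n (x : 'Z_(p ^ k.+1)) : (k < n)%N -> x *+ (p ^ n) = 0.
Proof.
move=> kn; rewrite -GRing.mulr_natr -(subnK kn) expnD GRing.natrM.
rewrite pchar_Zp ?GRing.mulr0 //.
by rewrite -[1%N](exp1n k.+1) ltn_exp2r // prime_gt1.
Qed.

Lemma expn_cyc_neq0 k : (p ^ k)%:R <> 0 :> 'Z_(p ^ k.+1).
Proof.
have p1 := prime_gt1 pp.
have pk1 : (1 < p ^ k.+1)%N by rewrite -[1%N](exp1n k.+1) ltn_exp2r.
move=> /(congr1 val) /=; rewrite val_Zp_nat // modn_small; last by rewrite ltn_exp2l.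
by apply/eqP; rewrite -lt0n expn_gt0 prime_gt0.
Qed.

End CyclicProduct.

(** * Test groups *)

Section TestGroup.
Variables (p : nat) (X T : Type) (alpha : T -> nat -> X).
Hypothesis pp : prime p.
Local Open Scope ring_scope.

Definition unit_vec b : cyc_prod p X := fun c => if `[< c = b >] then 1 else 0.

(* [tail_vec t n] is the infinite sum of the [p^(k-n) * unit_vec (alpha t k, k)] for [k >= n]. *)
Definition tail_vec (t : T) (n : nat) : cyc_prod p X := fun c =>
  if (n <= c.2)%N && `[< c.1 = alpha t c.2 >] then (p ^ (c.2 - n))%:R else 0.

(** With all tails among the generators, the remainder of [tail_elt t 0] after [n] terms is
    divisible by [p ^ n] in the group itself. *)
Definition test_gen (y : (X + T) * nat) : cyc_prod p X :=
  match y.1 with inl x => unit_vec (x, y.2) | inr t => tail_vec t y.2 end.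

Definition test_group : zmodType := spanned test_gen.

Definition unit_elt x n : test_group := spanned_gen test_gen (inl x, n).
Definition tail_elt t n : test_group := spanned_gen test_gen (inr t, n).

Lemma test_eq (u v : test_group) :
  (forall b, spanned_val u b = spanned_val v b) -> u = v.
Proof. by move=> uv; apply: val_inj; apply: cyc_eq. Qed.

Lemma test_valD (u v : test_group) b :
  spanned_val (u + v) b = spanned_val u b + spanned_val v b.
Proof. by []. Qed.

Lemma test_valN (u : test_group) b : spanned_val (- u) b = - spanned_val u b.
Proof. by []. Qed.

Lemma test_valM (u : test_group) n b :
  spanned_val (u *+ n) b = spanned_val u b *+ n.
Proof. by elim: n => // n IH; rewrite !GRing.mulrS test_valD IH. Qed.

Lemma tail_eltS t n : tail_elt t n = unit_elt (alpha t n) n + tail_elt t n.+1 *+ p.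
Proof.
apply: test_eq => -[x k]; rewrite test_valD test_valM /= /test_gen /= /unit_vec /tail_vec /=.
have -> : `[< (x, k) = (alpha t n, n) >] = (n == k) && `[< x = alpha t k >].
  by apply/asboolP/andP => [[-> ->]|[/eqP-> /asboolP->]//]; split=> //; exact/asboolP.
case: asboolP => _; rewrite ?andbT ?andbF ?GRing.mul0rn ?GRing.addr0 //.
have [nk|kn|->] := ltngtP n k; rewrite ?GRing.mul0rn ?GRing.addr0 ?subnn //.
by rewrite GRing.add0r -GRing.mulrnA mulnC -expnS subnSK.
Qed.

Lemma tail_elt0 t n :
  tail_elt t 0 = \sum_(k < n) unit_elt (alpha t k) k *+ (p ^ k) + tail_elt t n *+ (p ^ n).
Proof.
elim: n => [|n IH]; first by rewrite big_ord0 GRing.add0r.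
rewrite IH big_ord_recr /= tail_eltS GRing.mulrnDl GRing.addrA -GRing.mulrnA -expnS.
by [].
Qed.

(** A tail has infinite support, but one exponent serves all its coordinates: p^(k-n) modulo p^(k+1)
    is killed by p^(n+1). *)
Lemma test_torsion (a : test_group) : exists n, a *+ (p ^ n) = 0.
Proof.
suff [n an] : exists n, spanned_val a *+ (p ^ n) = 0.
  by exists n; apply: test_eq => b; rewrite test_valM -cyc_mulrnE an.
apply: (spanned_ind (P := fun u => exists n, u *+ (p ^ n) = 0)) => [|[[x|t] n]|u [n un]|u v [m um] [n vn]].
- by exists 0%N; rewrite GRing.mul0rn.
- exists n.+1; apply: cyc_eq => -[x' k]; rewrite cyc_mulrnE cyc_zeroE /test_gen /unit_vec /=.
  case: asboolP => [[_ ->]|_]; last by rewrite GRing.mul0rn.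
  exact: mulrn_cyc.
- exists n.+1; apply: cyc_eq => -[x' k]; rewrite cyc_mulrnE cyc_zeroE /test_gen /tail_vec /=.
  case: andP => [[nk _]|_]; last by rewrite GRing.mul0rn.
  by rewrite -GRing.mulrnA -expnD mulrn_cyc // addnS ltnS subnK.
- by exists n; rewrite GRing.mulNrn un GRing.oppr0.
- exists (m + n)%N; rewrite GRing.mulrnDl expnD GRing.mulrnA um GRing.mul0rn GRing.add0r.
  by rewrite mulnC GRing.mulrnA vn GRing.mul0rn.
Qed.

Lemma test_separable : separable_p_group p test_group.
Proof.
split=> [a|[a [/eqP a0 ha]]]; first exact: test_torsion.
apply: a0; apply: test_eq => -[x k]; have [y ->] := ha k.+1.
by rewrite test_valM; exact: mulrn_cyc.
Qed.

Lemma test_card (U : Type) : infinite_set [set: U] -> [set: X] #<= [set: U] ->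
  [set: T] #<= [set: U] -> [set: test_group] #<= [set: U].
Proof.
move=> inf XU TU; have [u0 _] := infinite_setN0 inf.
have NU : [set: nat] #<= [set: U] by exact/infiniteP.
have BU : [set: bool] #<= [set: U].
  by apply: card_le_trans NU; exact: countableP.
have [f [_ finj]] := card_leE u0 XU; have [g [_ ginj]] := card_leE u0 TU.
have SU : [set: X + T] #<= [set: U].
  apply: (@card_le_trans _ _ _ ([set: bool] `*` [set: U])); last exact: card_setX_square.
  apply: (card_leI (f := fun s : X + T => match s with inl x => (true, f x)
                                          | inr t => (false, g t) end)) => //.
  by move=> [x|t] [x'|t'] _ _ // []; [move/(finj _ _ I I) ->|move/(ginj _ _ I I) ->].
have YU : [set: bool * ((X + T) * nat)] #<= [set: U].
  by apply: card_prod_le => //; exact: card_prod_le.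
apply: card_le_trans (card_seq_le inf YU).
have /choice[s sP] (a : test_group) : exists s, spanned_val a = signed_sum test_gen s.
  by case: a => u uS; case/asboolP: (uS) => s us; exists s.
apply: (card_leI (f := s)) => // a b _ _ sab.
by apply: val_inj => /=; rewrite !sP sab.
Qed.

(** Generators have countable support and countable subsets of [X] are bounded; sums and opposites
    preserve this. *)
Lemma test_bounded (lt : X -> X -> Prop) (wo : strict_well_order lt) :
  (forall a b, exists2 c, lt a c & lt b c) ->
  (forall f : nat -> X, exists b, forall n, lt (f n) b) -> forall (t0 : X) (a : test_group),
  exists b, forall x k, ~ lt x b -> spanned_val a (x, k) = 0.
Proof.
move=> bd2 bdN t0 a; pose P (u : cyc_prod p X) := exists b, forall x k, ~ lt x b -> u (x, k) = 0.
change (P (val a)); apply: (spanned_ind (P := P)); rewrite /P.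
- by exists t0.
- move=> [[y|t] n].
    have [c yc _] := bd2 y y; exists c => x k xc; rewrite /test_gen /unit_vec /=.
    by case: asboolP => // -[xy]; case: xc; rewrite xy.
  have [c cP] := bdN (alpha t); exists c => x k xc; rewrite /test_gen /tail_vec /=.
  by case: andP => // -[_ /asboolP xa]; case: xc; rewrite xa.
- by move=> u [b bP]; exists b => x k /bP ub; rewrite cyc_oppE ub GRing.oppr0.
- move=> u v [b bP] [c cP]; have [d bd cd] := bd2 b c; exists d => x k xd.
  rewrite cyc_addE bP ?cP ?GRing.addr0 // => h; apply: xd; [exact: (swo_trans wo h cd)|exact: (swo_trans wo h bd)].
Qed.

End TestGroup.

(** * Traces of elements along guessed sequences *)

Section Invariant.
Variables (p : nat) (L M : Type) (lt : L -> L -> Prop) (ltM : M -> M -> Prop).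
Hypothesis pp : prime p.
Hypothesis wo : strict_well_order lt.
Hypothesis woM : strict_well_order ltM.
Hypothesis Lunc : ~ ([set: L] #<= [set: nat]).
Hypothesis Linit : forall x, ~ ([set: L] #<= seg lt x).
Hypothesis Lreg : forall (K : Type) (D : set K) (f : K -> L),
  ~ ([set: L] #<= D) -> exists x, forall k, D k -> lt (f k) x.
Local Open Scope ring_scope.

Let ltN (a b : nat * M) := (a.1 < b.1)%N \/ (a.1 = b.1 /\ ltM a.2 b.2).

Let woN : strict_well_order ltN := lexi_swo nat_swo woM.

Variables (C : L -> L -> nat * M -> L) (G : zmodType) (rho : G -> L).
Hypothesis guess : forall r : L -> L, exists d j,
  (forall n, closed_at lt r (C d j n)) /\ (forall m n, ltN m n -> lt (C d j m) (C d j n)).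
Hypothesis rho_inj : injective rho.

Definition trace d j (g : G) (i : nat * M) (n : nat) : Prop :=
  exists y z : G, lt (rho y) (C d j i) /\ g = y + z *+ (p ^ n.+1).

Let h (F : nat -> M) n := (n, F n).

(** Take the image of [tail_elt t 0]. If [h F n] precedes [i], its first n+1 terms sum to an element
    below [C d j i] and the rest is divisible by p^(n+1). If not, purity and the term p^n, nonzero
    modulo p^(n+1), exclude such a decomposition. *)
Lemma trace_realized (F : nat -> M) :
  (forall A : zmodType, separable_p_group p A -> [set: A] #<= [set: L] -> purely_embeddable A G) ->
  exists d j g, forall i n, trace d j g i n <-> ltN (h F n) i.
Proof.
move=> univ; have Linf : infinite_set [set: L].
  by move=> /finite_set_countable.
have bd2 := bound2 Lunc Lreg.
have bdN (f : nat -> L) : exists b, forall n, lt (f n) b.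
  by have [b bP] := Lreg f Lunc; exists b => n; exact: bP.
(* The guess is known only after the embedding, so the group gets tails for every pair [t]. *)
pose alpha (t : L * L) k := C t.1 t.2 (h F k).
have [H [[Hsub Hpure] [e [einj eH]]]] : purely_embeddable (test_group p alpha) G.
  apply: univ; first exact: test_separable.
  by apply: test_card => //; exact: card_prod_le.
have /choice[r1 r1P] x : exists b, forall n, lt (rho (e (unit_elt p alpha x n *+ (p ^ n)))) b.
  exact: bdN.
(* [F2] bounds the support of one element whose image is congruent to [y] modulo p^(n+1), if there
   is one. *)
have /choice[F2 F2P] (xn : L * nat) : exists b, forall (y : G), rho y = xn.1 ->
    (exists a z, e a - y = z *+ (p ^ xn.2.+1)) ->
    exists a z, e a - y = z *+ (p ^ xn.2.+1) /\
      forall c k, ~ lt c b -> spanned_val a (c, k) = 0.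
  have [[y [yx [a [z az]]]]|nex] := pselect (exists y : G, rho y = xn.1 /\
      exists a z, e a - y = z *+ (p ^ xn.2.+1)); last first.
    by exists xn.1 => y yx yaz; case: nex; exists y.
  have [b bP] := test_bounded wo bd2 bdN xn.1 a.
  by exists b => y'; rewrite -yx => /rho_inj -> _; exists a, z.
have /choice[r2 r2P] x := bdN (fun n => F2 (x, n)).
(* Addition read on codes; closed points then cut out sets stable under addition. *)
have /choice[F3 F3P] (xy : L * L) : exists b, forall u v, rho u = xy.1 -> rho v = xy.2 ->
    rho (u + v) = b.
  have [[u [v [ux vy]]]|nex] := pselect (exists u v, rho u = xy.1 /\ rho v = xy.2).
    by exists (rho (u + v)) => u' v'; rewrite -ux -vy => /rho_inj -> /rho_inj ->.
  by exists xy.1 => u v ux vy; case: nex; exists u, v.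
have [r3 r3P] := bound_seg2 wo Lunc Linit Lreg (fun x y => F3 (x, y)).
have /choice[r rP] x : exists b, [/\ lt (r1 x) b, lt (r2 x) b & lt (r3 x) b].
  have [b h1 h2] := bd2 (r1 x) (r2 x); have [c bc h3] := bd2 b (r3 x).
  by exists c; split=> //; [exact: (swo_trans wo h1 bc)|exact: (swo_trans wo h2 bc)].
have [d [j [Cr Cinc]]] := guess r.
pose t := (d, j); exists d, j, (e (tail_elt p alpha t 0)) => i n.
have closed_add u v : lt (rho u) (C d j i) -> lt (rho v) (C d j i) -> lt (rho (u + v)) (C d j i).
  move=> uC vC; rewrite (F3P (rho u, rho v) u v) //.
  have [uv|vu] := pselect (lt (rho u) (rho v)).
    have [_ _ rv] := rP (rho v).
    apply: (swo_trans wo (r3P _ _ _ (swo_asym wo uv) (swo_irr wo (x := rho v)))).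
    exact: (swo_trans wo rv (Cr i _ vC)).
  have [_ _ ru] := rP (rho u).
  apply: (swo_trans wo (r3P _ _ _ (swo_irr wo (x := rho u)) vu)).
  exact: (swo_trans wo ru (Cr i _ uC)).
split=> [[y [z [yC eyz]]]|hi].
- apply: contrapT => nhi.
  (* Replaces [y] by the image of an [a'] supported below [C d j i]. *)
  have [a' [z' [a'z' a'0]]] := F2P (rho y, n) y erefl (ex_intro _ _ (ex_intro _ z
    (etrans (congr1 (fun u => u - y) eyz) (etrans (GRing.addrC _ _) (GRing.addKr _ _))))).
  pose a := tail_elt p alpha t 0.
  have : (multiples (p ^ n.+1) [set: G] `&` H) (e (a - a')).
    split; last by rewrite -eH; exists (a - a').
    exists (z - z') => //=; rewrite GRing.mulrnBl -a'z'.
    have -> : e (a - a') = e a - e a' by exact: GRing.raddfB.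
    by rewrite eyz GRing.opprB GRing.addrA [_ + y]GRing.addrC.
  (* Purity brings the divisibility of [a - a'] back to the test group, where the coordinate
     [(b, n)] refutes it. *)
  rewrite -Hpure -eH => -[_ [a'' _ <-]]; rewrite -GRing.raddfMn => /einj aa.
  pose b := alpha t n.
  have b0 : ~ lt b (F2 (rho y, n)).
    have Cb : ~ lt b (C d j i).
      have [->|hn] := swo_le woN nhi; first exact: swo_irr.
      exact/(swo_asym wo)/Cinc.
    move=> bF; apply: Cb; have [_ r2r _] := rP (rho y).
    apply: (swo_trans wo bF); apply: (swo_trans wo (r2P _ n)).
    exact: (swo_trans wo r2r (Cr i _ yC)).
  have /esym := congr1 (fun u : test_group p alpha => spanned_val u (b, n)) aa.
  rewrite test_valD test_valN test_valM (a'0 _ _ b0) GRing.subr0 mulrn_cyc //.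
  rewrite /= /test_gen /tail_vec /= subn0; case: asboolP => // _.
  exact: expn_cyc_neq0.
- exists (e (\sum_(k < n.+1) unit_elt p alpha (alpha t k) k *+ (p ^ k))), (e (tail_elt p alpha t n.+1)).
  split; last by rewrite -GRing.raddfMn -GRing.raddfD -tail_elt0.
  have unitC k : (k <= n)%N -> lt (rho (e (unit_elt p alpha (alpha t k) k *+ (p ^ k)))) (C d j i).
    move=> kn; have [r1r _ _] := rP (alpha t k).
    apply: (swo_trans wo (r1P _ k)); apply: (swo_trans wo r1r); apply: Cr; apply: Cinc.
    have [->//|nk] := eqVneq k n; apply: (swo_trans woN _ hi); left => /=.
    by rewrite ltn_neqAle nk.
  suff sumC m : (m <= n)%N ->
      lt (rho (e (\sum_(k < m.+1) unit_elt p alpha (alpha t k) k *+ (p ^ k)))) (C d j i).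
    exact: sumC.
  elim: m => [|m IH] mn; first by rewrite big_ord1; exact: unitC.
  rewrite big_ord_recr GRing.raddfD /=; apply: closed_add; first by apply: IH; exact: ltnW.
  exact: unitC.
Qed.

(** A point of a strict total order is determined by the set of points above it. *)
Lemma trace_inj d j g (F F' : nat -> M) :
  (forall i n, trace d j g i n <-> ltN (h F n) i) ->
  (forall i n, trace d j g i n <-> ltN (h F' n) i) -> F = F'.
Proof.
move=> gF gF'; apply: funext => n.
have FF' i : ltN (h F n) i <-> ltN (h F' n) i by rewrite -gF -gF'.
have [[]//|[lt1|lt2]] := swo_total woN (h F n) (h F' n).
  by case: (swo_irr woN (x := h F' n)); apply/FF'.
by case: (swo_irr woN (x := h F n)); apply/FF'.
Qed.

End Invariant.

(** * Counting traces in a universal group *)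

Theorem theorem3p3 (p : nat) (L : Type) :
  prime p ->
  regular_cardinal L ->
  (exists M M' : Type,
     infinite_set [set: M] /\ is_card_succ M M' /\
     [set: M'] #< [set: L] /\ [set: L] #< [set: nat -> M]) ->
  ~ exists G : zmodType,
      separable_p_group p G /\ [set: G] #= [set: L] /\
      forall A : zmodType,
        separable_p_group p A -> [set: A] #<= [set: L] -> purely_embeddable A G.
Proof.
move=> pp [Linf [R [[Rwo Rinit] Rreg]]] [M [M' [Minf [[[MM' nM'M] _] [[M'L nLM'] [_ nML]]]]]].
move=> [G [_ [GL univ]]].
pose lt x y := R x y /\ x <> y.
have wo : strict_well_order lt := swo_of_well_order Rwo.
have Linit x : ~ ([set: L] #<= seg lt x) by case: (Rinit x).
have Lreg (K : Type) (D : set K) (f : K -> L) :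
    ~ ([set: L] #<= D) -> exists x, forall k, D k -> lt (f k) x.
  (* An unbounded image would be cofinal, hence of size [L]. *)
  move=> LD; have /existsNP[x nx] : ~ cofinal R (f @` D).
    move=> /Rreg fDL; apply: LD; apply: card_le_trans (card_image_le f D).
    by case/card_eqPle: fDL.
  exists x => k Dk; have nR : ~ R x (f k) by move=> xf; apply: nx; exists (f k) => //; exists k.
  have Rx : R x x.
    have [|m [[/asboolP mx lem] _]] := Rwo [pred y | `[< y = x >]].
      by exists x; apply/asboolP.
    by rewrite -{1}mx; apply: lem; exact/asboolP.
  have [xf|[[xf _]|//]] := swo_total wo x (f k); first by case: nR; rewrite -xf.
  by case: nR.
have NM : [set: nat] #<= [set: M] by exact/infiniteP.
have Lunc : ~ ([set: L] #<= [set: nat]).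
  by move=> LN; apply: nLM'; exact: card_le_trans LN (card_le_trans NM MM').
have [l0 _] := infinite_setN0 Linf.
(* The least point with more than [M] predecessors; one exists because the image of [M'] in [L] is
   bounded. *)
have [xs xsM xsmin] : exists2 xs, ~ (seg lt xs #<= [set: M]) &
    forall y, ~ (seg lt y #<= [set: M]) -> ~ lt y xs.
  have [f [_ finj]] := card_leE l0 M'L; have [x xP] := Lreg _ [set: M'] f nLM'.
  apply: (swo_least wo (P := fun x => ~ (seg lt x #<= [set: M])) (x := x)) => xM.
  by apply: nM'M; apply: card_le_trans xM; exact: (card_leI (f := f)).
have ltxsM x : lt x xs -> seg lt x #<= [set: M].
  by move=> xxs; apply: contrapT => /xsmin.
have [ltM woM] := exists_strict_well_order M.
have NMM : [set: nat * M] #<= [set: M].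
  exact: card_prod_le.
have [C CP] := club_guessing wo (lexi_swo nat_swo woM) Minf NMM Lunc Linit Lreg xsM ltxsM.
have /card_eqPle[GL' _] := GL.
have [rho [_ rinj]] := card_leE l0 GL'.
have rho_inj : injective rho by move=> x y; exact: rinj.
have real F := trace_realized pp wo woM Lunc Linit Lreg CP rho_inj F univ.
(* [F] can be recovered from a guess and an element realizing it, yet there are at most [L] such
   triples. *)
have /choice[phi phiP] (F : nat -> M) : exists t : L * (L * G), forall i n,
    trace p lt C rho t.1 t.2.1 t.2.2 i n <-> (n < i.1)%N \/ n = i.1 /\ ltM (F n) i.2.
  by have [d [j [g gP]]] := real F; exists (d, (j, g)).
apply: nML; apply: (@card_le_trans _ _ _ [set: L * (L * G)]).
  apply: (card_leI (f := phi)) => // F F' _ _ FF'.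
  by apply: (trace_inj woM (phiP F)) => i n; rewrite FF'; exact: phiP.
by do 2 (apply: card_prod_le => //).
Qed.
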